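(* Let $d,p\in\mathbb{N}$, $A\in\mathbb{C}^{d\times d}$, $x_0\in\mathbb{C}^d$, and consider the initial value problem $\dot{x}(t)=Ax$, $x(t_0)=x_0$. Let $\gamma:[0,1]\to\mathbb{C}$ be a non-constant $\mathcal{C}^1$-curve with $\gamma(0)=t_0\in\mathbb{C}$ and $\gamma(1)=t\in\mathbb{C}$, with length $L(\gamma):=\int_0^1|\dot\gamma(u)|\,du$. For every $n\in\mathbb{N}$ let $\tau_j(n):=\gamma\left(\frac{j+1}{n}\right)-\gamma\left(\frac{j}{n}\right)$, $j\in\{0,\dots,n-1\}$, and $\delta_n:=\max_{0\le j\le n-1}|\tau_j(n)|$. Let $C\in\mathbb{R}^+$ be a constant such that $\delta_n\le C\frac{L(\gamma)}{n}$ for all $n\in\mathbb{N}$. Let $x_n$ be the terminal value at $t$ of a $p$-stage explicit Runge-Kutta method of order $p$ applied to this problem along the time grid $\Delta_n^\gamma$, and let $\varepsilon_n=e^{(t-t_0)A}x_0-x_n$. If there is $N\in\mathbb{N}_0$ such that $$\sum_{j=0}^{n-1}\big(\tau_j(n)\big)^{p+1}=0\quad\text{for all } n\ge N,$$ then $$\lim_{n\to\infty}\frac{\varepsilon_n}{\delta_n^p}=\lim_{n\to\infty}\frac{e^{(t-t_0)A}x_0-x_n}{\delta_n^p}=0,$$ and the order of the method at the terminal point is increased from $p$ to $p+1$, i.e. $\varepsilon_n=\mathcal{O}\left(n^{-(p+1)}\right)$ as $n\to\infty$.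
   Context: For a curve $\gamma:[0,1]\to\mathbb{C}$ and $n\in\mathbb{N}$, $\Delta_n^\gamma=[t_0,\dots,t_n]$ with $t_j=\gamma(j/n)$ is the associated time grid; its steps $\tau_j(n)=t_{j+1}-t_j$ are complex numbers. An $s$-stage explicit Runge-Kutta method with coefficients $\mathfrak{A}\in\mathbb{C}^{s\times s}$ (strictly lower triangular), $\mathfrak{b},\mathfrak{c}\in\mathbb{C}^s$ applied to $\dot{x}=Ax$ has the one-step map $\Psi^{t+\tau,t}x=x+\tau\sum_{i=1}^s\mathfrak{b}_ik_i$, $k_i=Ax+\tau\sum_{j=1}^{i-1}\mathfrak{A}_{i,j}Ak_j$, $\tau\in\mathbb{C}$. The method has order $p$ in the usual sense: for sufficiently smooth right-hand sides the consistency error (exact flow minus one numerical step of size $\tau$) is $\mathcal{O}(|\tau|^{p+1})$ as $\tau\to0$. The grid function is $x_\Delta(t_0)=x_0$, $x_\Delta(t_{j+1})=\Psi^{t_{j+1},t_j}x_\Delta(t_j)$, defined recursively along the index $j$; $x_n$ is the value obtained at the last grid index $j=n$, i.e. at $t$. *)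

(* Defs.v *)
From HB Require Import structures.
From mathcomp Require Import all_boot all_order all_algebra.
From mathcomp Require Import all_classical all_reals all_analysis.
From mathcomp Require Export complex.

Set Implicit Arguments.
Unset Strict Implicit.
Unset Printing Implicit Defensive.

Import Order.TTheory GRing.Theory Num.Theory.
Import numFieldNormedType.Exports.

Local Open Scope classical_set_scope.
Local Open Scope complex_scope.
Local Open Scope ring_scope.

(* The instances that numFieldNormedType gives to the numFieldType variables,
   for the concrete type R[i]. *)
#[export, non_forgetful_inheritance]
HB.instance Definition _ (R : realType) :=
  PseudoPointedMetric.copy R[i] R[i]^o.
#[export, non_forgetful_inheritance]
HB.instance Definition _ (R : realType) := GRing.ComAlgebra.copy R[i] R[i]^o.
#[export, non_forgetful_inheritance]
HB.instance Definition _ (R : realType) := Vector.copy R[i] R[i]^o.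
#[export, non_forgetful_inheritance]
HB.instance Definition _ (R : realType) := NormedModule.copy R[i] R[i]^o.

(* The norm of R[i] in the Num hierarchy takes its values in R[i]; cmod is the
   same modulus as an element of R. *)
Notation cmod := ComplexField.Normc.normc.

Section RungeKutta.
Variable R : realType.
Local Notation C := R[i].

Record explicit_rk (s : nat) := ExplicitRK {
  rk_a : 'M[C]_s;
  rk_b : 'cV[C]_s;
  rk_c : 'cV[C]_s;
  rk_explicit : forall i j : 'I_s, (i <= j)%N -> rk_a i j = 0 }.

Section Step.
Variables (s m : nat) (M : explicit_rk s) (f : C -> 'cV[C]_m -> 'cV[C]_m).
Variables (t : C) (x : 'cV[C]_m) (tau : C).

Definition rk_stage_map (k : 'I_s -> 'cV[C]_m) : 'I_s -> 'cV[C]_m :=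
  fun i => f (t + rk_c M i 0 * tau)
             (x + tau *: \sum_(j < s | (j < i)%N) rk_a M i j *: k j).

(* Stage i depends on the stages j < i only, so that s sweeps of the stage
   equations, from any starting value, solve them; see rk_stageE. *)
Definition rk_stage : 'I_s -> 'cV[C]_m := iter s rk_stage_map (fun=> 0).

Definition rk_step : 'cV[C]_m :=
  x + tau *: \sum_(i < s) rk_b M i 0 *: rk_stage i.

Lemma rk_stageE (i : 'I_s) :
  rk_stage i =
    f (t + rk_c M i 0 * tau)
      (x + tau *: \sum_(j < s | (j < i)%N) rk_a M i j *: rk_stage j).
Proof.
have stab n : forall i : 'I_s, (i < n)%N ->
    iter n rk_stage_map (fun=> 0) i = iter n.+1 rk_stage_map (fun=> 0) i.
  elim: n => [//|n IHn] j jn; rewrite iterS [in RHS]iterS.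
  congr (f _ (_ + _ *: _)); apply: eq_bigr => l lj; congr (_ *: _).
  by apply: IHn; exact: leq_trans lj jn.
by rewrite {1}/rk_stage stab.
Qed.

End Step.

Lemma rk_stage_linearE (s m : nat) (M : explicit_rk s) (A : 'M[C]_m) (t : C)
    (x : 'cV[C]_m) (tau : C) (i : 'I_s) (k := rk_stage M (fun=> mulmx A) t x tau) :
  k i = A *m x + tau *: \sum_(j < s | (j < i)%N) rk_a M i j *: (A *m k j).
Proof.
rewrite {1}/k rk_stageE mulmxDr -scalemxAr mulmx_sumr; congr (_ + _ *: _).
by apply: eq_bigr => j _; rewrite -scalemxAr.
Qed.

(* Steps are complex, so the exact flow has to exist for complex times: the
   smooth right-hand sides are those that are holomorphic, i.e. differentiable
   over R[i], in a neighbourhood of the initial point. *)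
Definition has_order (s : nat) (M : explicit_rk s) (p : nat) : Prop :=
  forall (m : nat) (f : C -> 'cV[C]_m -> 'cV[C]_m) (t0 : C) (x : C -> 'cV[C]_m),
    (\forall z \near (t0, x t0),
       differentiable (fun y : C * 'cV[C]_m => f y.1 y.2) z) ->
    (\forall t \near t0, is_derive t (1 : C) x (f t (x t))) ->
    (fun tau : C => x (t0 + tau) - rk_step M f t0 (x t0) tau)
      =O_ (nbhs (0 : C)) (fun tau : C => tau ^+ p.+1).

Definition expmx (d : nat) (A : 'M[C]_d) : 'M[C]_d :=
  lim (series (fun k => (k`!%:R)^-1 *: A ^+ k) @ \oo).

Section Curve.
Variable gamma : R -> C.

Definition curve_quotient (u v : R) : C := (gamma v - gamma u) / (v - u)%:C.

(* Limits are taken inside [0, 1], hence one-sided at 0 and 1. *)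
Definition curve_derivable (u : R) : Prop :=
  cvg (curve_quotient u @ within `[0%R, 1%R] u^').

Definition curve_deriv (u : R) : C :=
  lim (curve_quotient u @ within `[0%R, 1%R] u^').

Definition C1_curve : Prop :=
  (forall u, u \in `[0, 1] -> curve_derivable u) /\
  {within `[0%R, 1%R], continuous curve_deriv}.

Definition curve_length : R :=
  \int[lebesgue_measure]_(u in `[0%R, 1%R]) cmod (curve_deriv u).

Definition grid_point (n j : nat) : C := gamma (j%:R / n%:R).

Definition grid_step (n j : nat) : C := grid_point n j.+1 - grid_point n j.

Definition mesh (n : nat) : R := \big[Num.max/0]_(j < n) cmod (grid_step n j).

Fixpoint grid_function (s m : nat) (M : explicit_rk s)
    (f : C -> 'cV[C]_m -> 'cV[C]_m) (x0 : 'cV[C]_m) (n j : nat) : 'cV[C]_m :=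
  if j is j'.+1 then
    rk_step M f (grid_point n j') (grid_function M f x0 n j') (grid_step n j')
  else x0.

End Curve.

End RungeKutta.

(* Main.v *)
Require Import Defs.
From mathcomp Require Import all_boot all_order all_algebra.
From mathcomp Require Import all_classical all_reals all_analysis.
From mathcomp Require Import complex ring lra.
Import Order.TTheory GRing.Theory Num.Theory.
Import numFieldNormedType.Exports.
Local Open Scope classical_set_scope.
Local Open Scope complex_scope.
Local Open Scope ring_scope.
Set Implicit Arguments.
Unset Strict Implicit.
Unset Printing Implicit Defensive.

(** On a linear problem a Runge-Kutta step with [s] stages multiplies the current
value by a polynomial in [tau *: A] of degree at most [s].  Testing order [p] on
the nilpotent shift, whose exact flow is itself a polynomial, forces the
coefficients up to degree [p] to be those of the exponential; with only [p]
stages nothing else is left, so the step is multiplication by the Taylor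
polynomial T of degree [p] ([rk_step_of_full_order]).

Everything in sight is a power series in the single matrix [A] and therefore
commutes.  Transporting the numerical value at the node [P j] back to the initial
node by the exact flow gives a sequence [y j] with
[y j.+1 = (1 + w j) *m y j], where
  w j = exp(- tau_j A) T(tau_j A) - 1
      = - tau_j^(p+1) A^(p+1) / (p+1)! + O(|tau_j|^(p+2)).
Expanding the product of the factors [1 + w j], the terms of degree two and more
in the [w j] contribute O((n n^-(p+1))^2) = O(n^-2p), which is O(n^-(p+1)) because
[p] is at least 1 ([norm1_perturbed_recursion]).  In the first-order term the
leading parts of the [w j] all carry the same matrix A^(p+1) / (p+1)!, so they add
up to a multiple of the power sum of the steps, which vanishes; the remainders add
up to O(n n^-(p+2)).  This is [norm1_global_error], and it gives the rate
n^-(p+1) at the terminal point.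

For the quotient by the p-th power of the mesh a lower bound c / n for the mesh is
needed: if the curve separates two parameters, so do the grid points close to them,
and their distance is at most [n] times the mesh ([mesh_lower_bound]).  This also
covers closed curves, where the distance of the end points gives nothing. *)

(** * The entrywise l1 norm of complex matrices *)

Section EntrywiseNorm.
Variable R : realType.
Local Notation C := R[i].
Implicit Types z w : C.

Lemma normr_cmod z : `|z| = (cmod z)%:C.
Proof. by []. Qed.

Lemma cmod_ge0 z : 0 <= cmod z.
Proof. by case: z => a b; exact: sqrtr_ge0. Qed.

Lemma cmodD z w : cmod (z + w) <= cmod z + cmod w.
Proof. by rewrite -lecR rmorphD; exact: (ler_normD z w). Qed.

Lemma cmodN z : cmod (- z) = cmod z.
Proof. by apply: (@complexI R); exact: (normrN z). Qed.

Lemma cmodM z w : cmod (z * w) = cmod z * cmod w.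
Proof. exact: ComplexField.Normc.normcM. Qed.

Lemma cmodX z n : cmod (z ^+ n) = cmod z ^+ n.
Proof.
elim: n => [|n IHn]; first by rewrite !expr0; exact: ComplexField.Normc.normc1.
by rewrite !exprS cmodM IHn.
Qed.

Lemma cmodB z w : cmod (z - w) = cmod (w - z).
Proof. by rewrite -cmodN opprB. Qed.

Lemma cmod_real (a : R) : cmod a%:C = `|a|.
Proof. by rewrite /= expr0n addr0 sqrtr_sqr. Qed.

Lemma cmod_nat n : cmod (n%:R : C) = n%:R.
Proof. by rewrite -(rmorph_nat (real_complex R)) cmod_real normr_nat. Qed.

Lemma cmodV z : cmod z^-1 = (cmod z)^-1.
Proof. exact: ComplexField.Normc.normcV. Qed.

Lemma cmod_sum (I : Type) (r : seq I) (P : pred I) (F : I -> C) :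
  cmod (\sum_(i <- r | P i) F i) <= \sum_(i <- r | P i) cmod (F i).
Proof.
elim/big_rec2: _ => [|i y x _ h]; first by rewrite ComplexField.Normc.normc0.
by apply: le_trans (cmodD _ _) _; rewrite lerD2l.
Qed.

Lemma cmod_le_ReIm z : cmod z <= `|complex.Re z| + `|complex.Im z|.
Proof.
rewrite {1}[z]complexE; apply: le_trans (cmodD _ _) _.
rewrite cmodM !cmod_real.
by rewrite [cmod 'i]/= expr0n/= expr1n add0r sqrtr1 mul1r.
Qed.

Lemma normRe_le_cmod z : `|complex.Re z| <= cmod z.
Proof.
case: z => a b /=; rewrite -sqrtr_sqr ler_wsqrtr // lerDl; exact: sqr_ge0.
Qed.

Lemma normIm_le_cmod z : `|complex.Im z| <= cmod z.
Proof.
case: z => a b /=; rewrite -sqrtr_sqr ler_wsqrtr // lerDr; exact: sqr_ge0.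
Qed.

(** The max norm that matrices carry takes its values in [R[i]] and is not
submultiplicative; the l1 norm is real-valued and submultiplicative for rectangular
matrices of all shapes, so that it bounds matrices and vectors alike. *)
Definition norm1 m n (M : 'M[C]_(m, n)) : R := \sum_i \sum_j cmod (M i j).

Lemma norm1_ge0 m n (M : 'M[C]_(m, n)) : 0 <= norm1 M.
Proof. by apply: sumr_ge0 => i _; apply: sumr_ge0 => j _; exact: cmod_ge0. Qed.

Lemma norm1_0 m n : norm1 (0 : 'M[C]_(m, n)) = 0.
Proof.
rewrite /norm1 big1 // => i _; rewrite big1 // => j _.
by rewrite mxE; exact: ComplexField.Normc.normc0.
Qed.

Lemma norm1D m n (M N : 'M[C]_(m, n)) : norm1 (M + N) <= norm1 M + norm1 N.
Proof.
rewrite /norm1 -big_split; apply: ler_sum => i _; rewrite -big_split.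
by apply: ler_sum => j _; rewrite mxE; exact: cmodD.
Qed.

Lemma norm1N m n (M : 'M[C]_(m, n)) : norm1 (- M) = norm1 M.
Proof.
by apply: eq_bigr => i _; apply: eq_bigr => j _; rewrite mxE cmodN.
Qed.

Lemma norm1B m n (M N : 'M[C]_(m, n)) : norm1 (M - N) = norm1 (N - M).
Proof. by rewrite -norm1N opprB. Qed.

Lemma norm1Z m n z (M : 'M[C]_(m, n)) : norm1 (z *: M) = cmod z * norm1 M.
Proof.
rewrite mulr_sumr; apply: eq_bigr => i _; rewrite mulr_sumr.
by apply: eq_bigr => j _; rewrite mxE cmodM.
Qed.

Lemma norm1_sum m n (I : Type) (r : seq I) (P : pred I) (F : I -> 'M[C]_(m, n)) :
  norm1 (\sum_(i <- r | P i) F i) <= \sum_(i <- r | P i) norm1 (F i).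
Proof.
elim/big_rec2: _ => [|i y x _ h]; first by rewrite norm1_0.
by apply: le_trans (norm1D _ _) _; rewrite lerD2l.
Qed.

Lemma cmod_le_norm1 m n (M : 'M[C]_(m, n)) i j : cmod (M i j) <= norm1 M.
Proof.
rewrite /norm1 (bigD1 i) //= (bigD1 j) //= -addrA lerDl addr_ge0 //.
  by apply: sumr_ge0 => k _; exact: cmod_ge0.
by apply: sumr_ge0 => k _; apply: sumr_ge0 => l _; exact: cmod_ge0.
Qed.

Lemma norm1M m n q (M : 'M[C]_(m, n)) (N : 'M[C]_(n, q)) :
  norm1 (M *m N) <= norm1 M * norm1 N.
Proof.
have row_le k : \sum_j cmod (N k j) <= norm1 N.
  rewrite /norm1 [leRHS](bigD1 k) //= lerDl.
  by apply: sumr_ge0 => l _; apply: sumr_ge0 => j _; exact: cmod_ge0.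
rewrite mulr_suml; apply: ler_sum => i _; rewrite mulr_suml.
apply: (@le_trans _ _ (\sum_j \sum_k cmod (M i k) * cmod (N k j))).
  apply: ler_sum => j _; rewrite mxE; apply: le_trans (cmod_sum _ _ _) _.
  by apply: ler_sum => k _; rewrite cmodM.
rewrite exchange_big /=; apply: ler_sum => k _.
by rewrite -mulr_sumr ler_wpM2l ?cmod_ge0.
Qed.

(** The factor [norm1 1%:M], equal to [d], is there for the exponent 0. *)
Lemma norm1X d (A : 'M[C]_d) n :
  norm1 (A ^+ n) <= norm1 (1%:M : 'M[C]_d) * norm1 A ^+ n.
Proof.
elim: n => [|n IHn]; first by rewrite !expr0 mulr1.
rewrite exprSr [norm1 A ^+ _]exprSr mulrA; apply: le_trans (norm1M _ _) _.
by rewrite ler_wpM2r ?norm1_ge0.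
Qed.

Lemma mxnorm_le_norm1 m n (M : 'M[C]_(m, n)) : `|M| <= (norm1 M)%:C.
Proof.
have [->|M0] := eqVneq `|M| 0; first by rewrite ler0c norm1_ge0.
have [k Mk] := mx_norm_neq0 M0; rewrite [leLHS]Mk.
by rewrite normr_cmod lecR cmod_le_norm1.
Qed.

Lemma normr_le_mxnorm m n (M : 'M[C]_(m, n)) i j : `|M i j| <= `|M|.
Proof.
rewrite -[`|M|]/(mx_norm M) mx_normE -[leLHS]nngE num_le.
exact: (le_bigmax _ (fun k : 'I_m * 'I_n => `|M k.1 k.2|%:nng) (i, j)).
Qed.

Lemma cvg_norm1 m n (X : nat -> 'M[C]_(m, n)) (L : 'M[C]_(m, n)) :
  (fun k => norm1 (X k - L)) @ \oo --> (0 : R) -> X @ \oo --> L.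
Proof.
move=> /cvgrPdist_lt XL; apply/cvgrPdist_lt => e e0.
have e_real : e = (complex.Re e)%:C by rewrite RRe_real // gtr0_real.
have Re0 : 0 < complex.Re e by rewrite -(@ltcR R) -e_real.
near=> k; rewrite distrC; apply: le_lt_trans (mxnorm_le_norm1 _) _.
rewrite e_real ltcR.
have : `|0 - norm1 (X k - L)| < complex.Re e by near: k; exact: XL.
by rewrite sub0r normrN ger0_norm ?norm1_ge0.
Unshelve. all: by end_near. Qed.

End EntrywiseNorm.

(** * The exponential of a complex matrix *)

Section MatrixExponential.
Variable R : realType.
Local Notation C := R[i].

Lemma cvg0D (f g : nat -> R) : f @ \oo --> (0 : R) -> g @ \oo --> (0 : R) ->
  (fun k => f k + g k) @ \oo --> (0 : R).
Proof.
move=> f0 g0; suff: (fun k => f k + g k) @ \oo --> (0 + 0 : R) by rewrite addr0.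
exact: cvgD.
Qed.

Lemma cvg_dist0 (u : nat -> R) : cvgn u -> (fun k => `|u k - limn u|) @ \oo --> (0 : R).
Proof.
move=> /cvgrPdist_lt u_cvg; apply/cvgrPdist_lt => e /u_cvg; apply: filterS => k.
by rewrite sub0r normrN normr_id distrC.
Qed.

Lemma cvg0_sum (I : Type) (r : seq I) (F : I -> nat -> R) :
  (forall i, F i @ \oo --> (0 : R)) ->
  (fun k => \sum_(i <- r) F i k) @ \oo --> (0 : R).
Proof.
move=> F0; elim: r => [|i r IHr].
  by under eq_fun do rewrite big_nil; exact: cvg_cst.
under eq_fun do rewrite big_cons.
exact: cvg0D.
Qed.

(** Real and imaginary parts of the entries are real series dominated by [v], so the
completeness of [R] suffices. *)
Lemma norm1_series_cvg m n (U : nat -> 'M[C]_(m, n)) (v : nat -> R) :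
  (forall k, norm1 (U k) <= v k) -> cvgn (series v) ->
  exists L, (fun k => norm1 (series U k - L)) @ \oo --> (0 : R).
Proof.
move=> Uv v_cvg.
have part_cvg (f : C -> R) i j : (forall z, `|f z| <= cmod z) ->
    cvgn (series (fun k => f (U k i j))).
  move=> f_le; apply: normed_cvg; apply: series_le_cvg v_cvg => k //=.
    by apply: le_trans (Uv k); exact: norm1_ge0.
  by apply: le_trans (f_le _) _; apply: le_trans (Uv k); exact: cmod_le_norm1.
pose a i j := limn (series (fun k => complex.Re (U k i j))).
pose b i j := limn (series (fun k => complex.Im (U k i j))).
have ReD : {morph @complex.Re R : x y / x + y} by move=> [? ?] [].
have ImD : {morph @complex.Im R : x y / x + y} by move=> [? ?] [].
exists (\matrix_(i, j) (a i j +i* b i j)).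
apply: (@squeeze_cvgr _ _ _ _ (fun=> 0) (fun k => \sum_i \sum_j
  (`|series (fun k => complex.Re (U k i j)) k - a i j| +
   `|series (fun k => complex.Im (U k i j)) k - b i j|))).
- near=> k; rewrite norm1_ge0 /=.
  apply: ler_sum => i _; apply: ler_sum => j _.
  apply: le_trans (cmod_le_ReIm _) _.
  rewrite !mxE /series /= summxE ReD ImD.
  rewrite (big_morph _ ReD (erefl : complex.Re 0 = 0)).
  by rewrite (big_morph _ ImD (erefl : complex.Im 0 = 0)).
- exact: cvg_cst.
- apply: cvg0_sum => i; apply: cvg0_sum => j.
  apply: cvg0D.
    apply: cvg_dist0; apply: part_cvg => z; exact: normRe_le_cmod.
  apply: cvg_dist0; apply: part_cvg => z; exact: normIm_le_cmod.
Unshelve. all: by end_near. Qed.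

Section Truncations.
Variables (d : nat) (A : 'M[C]_d).

(** The powers of [z] are kept apart from those of [A], so that truncations at
different times are combinations of the same matrices. *)
Definition exp_trunc (N : nat) (z : C) : 'M[C]_d :=
  \sum_(0 <= k < N) (z ^+ k / k`!%:R) *: A ^+ k.

Lemma scalemxX z k : (z *: A) ^+ k = z ^+ k *: A ^+ k.
Proof.
elim: k => [|k IHk]; first by rewrite !expr0 scale1r.
by rewrite !exprS IHk -!mulmxE -scalemxAl -scalemxAr scalerA.
Qed.

Lemma series_expmxE z :
  series (fun k => (k`!%:R)^-1 *: (z *: A) ^+ k) = exp_trunc^~ z.
Proof.
apply/funext => N; apply: eq_bigr => k _.
by rewrite scalemxX scalerA mulrC.
Qed.

(** All estimates on the matrix series go through this comparison with the real
exponential series, whose functional equation and convergence are known. *)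
Lemma norm1_exp_term z k :
  norm1 ((z ^+ k / k`!%:R) *: A ^+ k) <=
  norm1 (1%:M : 'M[C]_d) * exp_coeff (cmod z * norm1 A) k.
Proof.
rewrite norm1Z cmodM cmodX cmodV cmod_nat /exp_coeff /= exprMn.
apply: (le_trans (ler_wpM2l _ (norm1X A k))).
  by rewrite divr_ge0 ?ler0n // exprn_ge0 ?cmod_ge0.
by rewrite le_eqVlt; apply/orP; left; apply/eqP; ring.
Qed.

Lemma norm1_exp_sum (r : seq nat) z :
  norm1 (\sum_(k <- r) (z ^+ k / k`!%:R) *: A ^+ k) <=
  norm1 (1%:M : 'M[C]_d) * \sum_(k <- r) exp_coeff (cmod z * norm1 A) k.
Proof.
apply: le_trans (norm1_sum _ _ _) _; rewrite mulr_sumr.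
by apply: ler_sum => k _; exact: norm1_exp_term.
Qed.

Lemma series_exp_coeff_le_expR (x : R) N : 0 <= x -> series (exp_coeff x) N <= expR x.
Proof.
move=> x0; apply: nondecreasing_cvgn_le; last exact: is_cvg_series_exp_coeff.
by apply: nondecreasing_series => k _ _; exact: exp_coeff_ge0.
Qed.

Lemma expmx_cvg z :
  (fun N => norm1 (exp_trunc N z - expmx (z *: A))) @ \oo --> (0 : R).
Proof.
pose v k := norm1 (1%:M : 'M[C]_d) * exp_coeff (cmod z * norm1 A) k.
have term_le k : norm1 ((k`!%:R)^-1 *: (z *: A) ^+ k) <= v k.
  by rewrite scalemxX scalerA mulrC; exact: norm1_exp_term.
have v_cvg : cvgn (series v).
  exact: (@is_cvg_seriesZ R _ _ (is_cvg_series_exp_coeff (cmod z * norm1 A))).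
have [L] := norm1_series_cvg term_le v_cvg.
rewrite series_expmxE => TL; suff -> : expmx (z *: A) = L by [].
rewrite /expmx series_expmxE; apply: cvg_lim; first exact: norm_hausdorff.
exact: cvg_norm1.
Qed.

End Truncations.

(** Bounds that hold for all large truncations pass to the exponential. *)
Lemma norm1_le_of_cvg m n (X : nat -> 'M[C]_(m, n)) L Y (c : R) :
  (fun N => norm1 (X N - L)) @ \oo --> (0 : R) ->
  (\forall N \near \oo, norm1 (X N - Y) <= c) -> norm1 (L - Y) <= c.
Proof.
move=> XL Xc; suff: norm1 (L - Y) <= 0 + c by rewrite add0r.
have XLc : (fun N => norm1 (X N - L) + c) @ \oo --> (0 + c : R).
  by apply: cvgD => //; exact: cvg_cst.
apply: (ler_cvg_to (@cvg_cst _ (norm1 (L - Y)) _ _ _) XLc).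
near=> N.
have -> : L - Y = (L - X N) + (X N - Y) by rewrite addrA subrK.
apply: le_trans (norm1D _ _) _; rewrite /= (norm1B L) lerD2l; near: N.
exact: Xc.
Unshelve. all: by end_near. Qed.

Lemma norm1_le0 m n (M : 'M[C]_(m, n)) : norm1 M <= 0 -> M = 0.
Proof.
move=> M0; apply/matrixP => i j; rewrite mxE.
apply: (@ComplexField.Normc.eq0_normc R); apply/eqP.
by rewrite eq_le cmod_ge0 (le_trans (cmod_le_norm1 _ _ _)).
Qed.

Lemma sum_triangle (V : nmodType) (F : nat -> nat -> V) N :
  \sum_(0 <= i < N) \sum_(0 <= j < N - i) F i j =
  \sum_(0 <= k < N) \sum_(0 <= i < k.+1) F i (k - i)%N.
Proof.
elim: N => [|N IHN]; first by rewrite !big_geq.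
rewrite [RHS]big_nat_recr //= -IHN [in RHS]big_nat_recr //= subnn addrA.
rewrite -big_split /= [LHS]big_nat_recr //= subSnn big_nat1; congr (_ + _).
rewrite !big_mkord; apply: eq_bigr => i _.
by rewrite subSn ?(ltnW (ltn_ord i)) // big_nat_recr.
Qed.

(** The part of a Cauchy product square that lies beyond the antidiagonal is kept as
an explicit remainder: for matrices it is bounded by the same remainder for reals. *)
Lemma sum_square (V : nmodType) (F : nat -> nat -> V) N :
  \sum_(0 <= i < N) \sum_(0 <= j < N) F i j =
  \sum_(0 <= k < N) \sum_(0 <= i < k.+1) F i (k - i)%N +
  \sum_(0 <= i < N) \sum_(N - i <= j < N) F i j.
Proof.
rewrite -sum_triangle -big_split /=; apply: eq_bigr => i _.
by rewrite -big_cat_nat // leq_subr.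
Qed.

Lemma exp_term_binomial (K : numFieldType) (a b : K) k :
  \sum_(0 <= i < k.+1) (a ^+ i / i`!%:R) * (b ^+ (k - i) / (k - i)`!%:R) =
  (a + b) ^+ k / k`!%:R.
Proof.
rewrite addrC exprDn mulr_suml big_mkord; apply: eq_bigr => i _.
have ik : (i <= k)%N by rewrite -ltnS.
have fact_neq0 n : (n`!%:R : K) != 0 by rewrite pnatr_eq0 -lt0n fact_gt0.
rewrite -(bin_fact ik) !natrM -mulr_natr.
have bin_neq0 : 'C(k, i)%:R != 0 :> K by rewrite pnatr_eq0 -lt0n bin_gt0.
by field; rewrite !fact_neq0.
Qed.

Section FunctionalEquation.
Variables (d : nat) (A : 'M[C]_d).

Lemma exp_truncM N a b :
  exp_trunc A N a *m exp_trunc A N b = exp_trunc A N (a + b) +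
  \sum_(0 <= i < N) \sum_(N - i <= j < N)
    ((a ^+ i / i`!%:R) * (b ^+ j / j`!%:R)) *: A ^+ (i + j).
Proof.
rewrite /exp_trunc mulmx_suml.
under eq_bigr do rewrite mulmx_sumr.
under eq_bigr do under eq_bigr do
  rewrite -scalemxAl -scalemxAr scalerA mulmxE -exprD.
rewrite (sum_square (fun i j => ((a ^+ i / i`!%:R) * (b ^+ j / j`!%:R)) *: A ^+ (i + j))).
congr (_ + _); apply: eq_bigr => k _; rewrite -exp_term_binomial scaler_suml.
rewrite [LHS]big_mkord [RHS]big_mkord; apply: eq_bigr => i _.
by rewrite subnKC // -ltnS.
Qed.

Lemma series_exp_coeffM N (a b : R) :
  series (exp_coeff a) N * series (exp_coeff b) N = series (exp_coeff (a + b)) N +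
  \sum_(0 <= i < N) \sum_(N - i <= j < N) exp_coeff a i * exp_coeff b j.
Proof.
rewrite /series /=.
have -> : (\sum_(0 <= k < N) exp_coeff a k) * (\sum_(0 <= k < N) exp_coeff b k) =
    \sum_(0 <= i < N) \sum_(0 <= j < N) exp_coeff a i * exp_coeff b j.
  by rewrite mulr_suml; apply: eq_bigr => i _; rewrite mulr_sumr.
rewrite (sum_square (fun i j => exp_coeff a i * exp_coeff b j)).
by congr (_ + _); apply: eq_bigr => k _; exact: exp_term_binomial.
Qed.

Let D := norm1 (1%:M : 'M[C]_d).

(** The bound is a difference of real truncations whose limit is
[expR x * expR y - expR (x + y)]; it tends to 0, and no estimate of tails is
required. *)
Lemma norm1_exp_truncM_le N a b (x := cmod a * norm1 A) (y := cmod b * norm1 A) :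
  norm1 (exp_trunc A N a *m exp_trunc A N b - exp_trunc A N (a + b)) <=
  D * (series (exp_coeff x) N * series (exp_coeff y) N -
       series (exp_coeff (x + y)) N).
Proof.
rewrite exp_truncM series_exp_coeffM.
rewrite [X in norm1 X <= _]addrAC subrr add0r [X in _ <= _ * X]addrAC subrr add0r.
apply: le_trans (norm1_sum _ _ _) _; rewrite mulr_sumr; apply: ler_sum => i _.
apply: le_trans (norm1_sum _ _ _) _; rewrite mulr_sumr; apply: ler_sum => j _.
rewrite norm1Z !cmodM !cmodX !cmodV !cmod_nat /exp_coeff /= !exprMn.
have c_ge0 : 0 <= cmod a ^+ i / i`!%:R * (cmod b ^+ j / j`!%:R).
  by rewrite mulr_ge0 // divr_ge0 ?ler0n // exprn_ge0 ?cmod_ge0.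
apply: (le_trans (ler_wpM2l c_ge0 (norm1X A (i + j)))).
by rewrite -/D exprD le_eqVlt; apply/orP; left; apply/eqP; ring.
Qed.

Lemma norm1_exp_trunc_le N z : norm1 (exp_trunc A N z) <= D * expR (cmod z * norm1 A).
Proof.
apply: le_trans (norm1_exp_sum _ _ _) _; rewrite ler_wpM2l ?norm1_ge0 //.
by apply: series_exp_coeff_le_expR; rewrite mulr_ge0 ?cmod_ge0 ?norm1_ge0.
Qed.

Lemma expmxD a b :
  expmx ((a + b) *: A) = expmx (a *: A) *m expmx (b *: A).
Proof.
set T := exp_trunc A; set E := fun z => expmx (z *: A).
pose x := cmod a * norm1 A; pose y := cmod b * norm1 A.
apply/eqP; rewrite eq_sym -subr_eq0; apply/eqP/norm1_le0.
pose f N := norm1 (T N a - E a) * norm1 (E b) +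
  D * expR x * norm1 (T N b - E b) +
  D * (series (exp_coeff x) N * series (exp_coeff y) N -
       series (exp_coeff (x + y)) N) + norm1 (T N (a + b) - E (a + b)).
have f0 : f @ \oo --> (0 * norm1 (E b) + D * expR x * 0 +
    D * (expR x * expR y - expR (x + y)) + 0 : R).
  apply: cvgD; last exact: expmx_cvg.
  apply: cvgD.
    by apply: cvgD; apply: cvgM;
      [exact: expmx_cvg|exact: cvg_cst|exact: cvg_cst|exact: expmx_cvg].
  apply: cvgM; first exact: cvg_cst.
  by apply: cvgB; [apply: cvgM|]; exact: is_cvg_series_exp_coeff.
move: f0; rewrite expRD subrr !mulr0 mul0r !addr0 => f0.
apply: (ler_cvg_to (@cvg_cst _ _ _ _ _) f0).
near=> N; rewrite /f /=.
have -> : expmx (a *: A) *m expmx (b *: A) - expmx ((a + b) *: A) =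
  - ((T N a - E a) *m E b) - T N a *m (T N b - E b) +
  (T N a *m T N b - T N (a + b)) + (T N (a + b) - E (a + b)).
  by rewrite mulmxBl mulmxBr !opprB !(addrA, subrK).
apply: le_trans (norm1D _ _) _; rewrite lerD2r.
apply: le_trans (norm1D _ _) _; rewrite lerD ?norm1_exp_truncM_le //.
apply: le_trans (norm1D _ _) _; rewrite !norm1N lerD //.
  exact: norm1M.
apply: le_trans (norm1M _ _) _; rewrite ler_wpM2r ?norm1_ge0 //.
exact: norm1_exp_trunc_le.
Unshelve. all: by end_near. Qed.

Lemma expmx0 : expmx (0 *: A) = 1%:M.
Proof.
apply/eqP; rewrite -subr_eq0; apply/eqP/norm1_le0.
apply: norm1_le_of_cvg (expmx_cvg A 0) _; near=> N.
have N0 : (0 < N)%N by near: N; exact: nbhs_infty_gt.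
rewrite /exp_trunc big_ltn // big_add1 big1 => [|k _]; last first.
  by rewrite expr0n mul0r scale0r.
by rewrite expr0 fact0 divr1 scale1r expr0 addr0 subrr norm1_0.
Unshelve. all: by end_near. Qed.

Lemma expmxNK z : expmx (- z *: A) *m expmx (z *: A) = 1%:M.
Proof. by rewrite -expmxD addNr expmx0. Qed.

(** Used with truncations of the exponential for [X]: the flow and the numerical step
commute. *)
Lemma comm_expmx (X : 'M[C]_d) z :
  X *m A = A *m X -> X *m expmx (z *: A) = expmx (z *: A) *m X.
Proof.
move=> XA; have XT N : X *m exp_trunc A N z = exp_trunc A N z *m X.
  rewrite /exp_trunc mulmx_sumr mulmx_suml; apply: eq_bigr => k _.
  rewrite -scalemxAr -scalemxAl; congr (_ *: _).
  by apply/(@commrX _ X A k).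
set E := expmx _; apply/eqP; rewrite -subr_eq0; apply/eqP/norm1_le0.
have f0 : (fun N => norm1 X * norm1 (exp_trunc A N z - E) +
    norm1 (exp_trunc A N z - E) * norm1 X) @ \oo -->
    (norm1 X * 0 + 0 * norm1 X : R).
  by apply: cvgD; apply: cvgM;
    [exact: cvg_cst|exact: expmx_cvg|exact: expmx_cvg|exact: cvg_cst].
rewrite mulr0 mul0r addr0 in f0.
apply: (ler_cvg_to (@cvg_cst _ _ _ _ _) f0); near=> N; rewrite /=.
have -> : X *m E - E *m X =
    - (X *m (exp_trunc A N z - E)) + (exp_trunc A N z - E) *m X.
  by rewrite mulmxBr mulmxBl XT opprB addrA subrK.
by apply: le_trans (norm1D _ _) _; rewrite norm1N lerD ?norm1M.
Unshelve. all: by end_near. Qed.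

(** The restriction to the unit disc lets [cmod z ^+ q] be factored out of the whole
tail, leaving the series of [expR (norm1 A)]. *)
Lemma norm1_expmx_rem q z : cmod z <= 1 ->
  norm1 (expmx (z *: A) - exp_trunc A q z) <= D * expR (norm1 A) * cmod z ^+ q.
Proof.
move=> z1; apply: norm1_le_of_cvg (expmx_cvg A z) _; near=> N.
have qN : (q <= N)%N by near: N; exact: nbhs_infty_ge.
rewrite /exp_trunc (big_cat_nat (leq0n q) qN) //= addrC addrK.
apply: le_trans (norm1_exp_sum _ _ _) _; rewrite -mulrA ler_wpM2l ?norm1_ge0 //.
apply: (@le_trans _ _ (\sum_(q <= k < N) exp_coeff (norm1 A) k * cmod z ^+ q)).
  apply: ler_sum_nat => k /andP[qk _]; rewrite /exp_coeff /= exprMn.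
  rewrite -[leLHS]mulrA [leLHS]mulrC ler_wpM2l //.
    by rewrite divr_ge0 ?ler0n ?exprn_ge0 ?norm1_ge0.
  by apply: ler_wiXn2l => //; exact: cmod_ge0.
rewrite -mulr_suml ler_wpM2r ?exprn_ge0 ?cmod_ge0 //.
apply: le_trans (series_exp_coeff_le_expR N (norm1_ge0 A)).
rewrite /series /= (big_cat_nat (leq0n q) qN) //= lerDr.
by apply: sumr_ge0 => k _; rewrite exp_coeff_ge0 ?norm1_ge0.
Unshelve. all: by end_near. Qed.

End FunctionalEquation.
End MatrixExponential.

(** * Runge-Kutta steps on linear problems *)

Section LinearRungeKutta.
Variable R : realType.
Local Notation C := R[i].

Section StabilityPolynomial.
Variables (s : nat) (M : explicit_rk R s).

(** [stage_weight l] is a^l 1, for the matrix a of the tableau, and [step_weight l]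
is b^T a^l 1, the weight of the unbranched tree with [l.+1] nodes; these trees are
the only ones whose elementary differential survives on a linear problem. *)
Definition stage_weight (l : nat) : 'cV[C]_s := rk_a M ^+ l *m const_mx 1.

Definition step_weight (l : nat) : C := \sum_(i < s) rk_b M i 0 * stage_weight l i 0.

Lemma stage_weightS l i :
  stage_weight l.+1 i 0 = \sum_(j < s | (j < i)%N) rk_a M i j * stage_weight l j 0.
Proof.
rewrite /stage_weight exprS -mulmxE -mulmxA mxE (bigID (fun j : 'I_s => (j < i)%N)) /=.
rewrite [X in _ + X]big1 ?addr0 // => j.
by rewrite -leqNgt => /(rk_explicit M) ->; rewrite mul0r.
Qed.

(** The number [N] of terms is arbitrary above [i] so that the induction can use the
same formula with one term less for all the earlier stages; the missing term
vanishes because the tableau is strictly lower triangular. *)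
Lemma rk_stage_linear m (A : 'M[C]_m) t x tau N (i : 'I_s) : (i < N)%N ->
  rk_stage M (fun=> mulmx A) t x tau i =
  \sum_(l < N) (tau ^+ l * stage_weight l i 0) *: (A ^+ l.+1 *m x).
Proof.
elim: N i => [//|N IHN] i iN; rewrite rk_stage_linearE big_ord_recl; congr (_ + _).
  by rewrite expr1 expr0 mul1r /stage_weight expr0 mul1mx mxE scale1r.
under eq_bigr => j ji do rewrite (IHN j (leq_trans ji iN)) mulmx_sumr scaler_sumr.
rewrite exchange_big scaler_sumr; apply: eq_bigr => l _.
rewrite lift0 stage_weightS mulr_sumr scaler_suml scaler_sumr; apply: eq_bigr => j _.
rewrite -scalemxAr !scalerA mulmxA -[A *m A ^+ _]exprS; congr (_ *: _).
by rewrite (exprS tau); ring.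
Qed.

Lemma rk_step_linear m (A : 'M[C]_m) t x tau :
  rk_step M (fun=> mulmx A) t x tau =
  x + \sum_(l < s) (tau ^+ l.+1 * step_weight l) *: (A ^+ l.+1 *m x).
Proof.
congr (_ + _).
under eq_bigr => i _ do rewrite (rk_stage_linear _ _ _ _ (ltn_ord i)) scaler_sumr.
rewrite exchange_big scaler_sumr; apply: eq_bigr => l _.
rewrite mulr_sumr scaler_suml scaler_sumr; apply: eq_bigr => i _.
by rewrite !scalerA; congr (_ *: _); rewrite (exprS tau); ring.
Qed.

End StabilityPolynomial.

Lemma is_deriveZl (V W : normedModType C) (f : V -> C) (df : C) (w : W) x v :
  is_derive x v f df -> is_derive x v (fun z => f z *: w) (df *: w).
Proof.
move=> [f_ex f_val].
have quotient_cvg :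
    (fun h => h^-1 *: (((fun z => f z *: w) \o shift x) (h *: v) - f x *: w)) @ 0^'
      --> df *: w.
  have -> : (fun h => h^-1 *: (((fun z => f z *: w) \o shift x) (h *: v) - f x *: w)) =
      (fun h => (h^-1 *: ((f \o shift x) (h *: v) - f x)) *: w).
    by apply/funext => h; rewrite -scalerBl scalerA.
  by apply: cvgZr_tmp; rewrite -f_val.
by split; [apply/cvg_ex; exists (df *: w)|exact: cvg_lim].
Qed.

(** Linear right-hand sides are admissible test problems for the order of a method. *)
Lemma differentiable_mulmx_snd m n (B : 'M[C]_(m, n)) (z : C * 'cV[C]_n) :
  differentiable (fun y : C * 'cV[C]_n => B *m y.2) z.
Proof.
have -> : (fun y : C * 'cV[C]_n => B *m y.2) =
      \sum_(j < n) (fun y : C * 'cV[C]_n => y.2 j 0 *: col j B).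
  apply/funext => y; rewrite fct_sumE; apply/matrixP => i k.
  by rewrite (ord1 k) summxE mxE; apply: eq_bigr => j _; rewrite !mxE mulrC.
apply: differentiable_sum => j; apply: differentiableZl.
apply: (@differentiable_comp _ _ _ _ snd (fun v : 'cV[C]_n => v j 0)).
  apply: linear_differentiable => -[a b]; exact: cvg_snd.
exact: differentiable_coord.
Qed.

(** The order conditions are read off from the nilpotent shift, as its powers applied
to the first basis vector are linearly independent up to the dimension and its flow
needs no convergence argument. *)
Definition shift_mx m : 'M[C]_m := \matrix_(i, j) (i == j.+1 :> nat)%:R.

(** The index is a natural number so that the basis vector past the dimension is 0
and the shift has no boundary case. *)
Definition unit_col m (k : nat) : 'cV[C]_m := \col_i (i == k :> nat)%:R.

Lemma shift_unit_col m k : shift_mx m *m unit_col m k = unit_col m k.+1.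
Proof.
apply/matrixP => i o; rewrite !mxE.
have [km|mk] := ltnP k m; last first.
  rewrite big1 => [|j _]; last first.
    by rewrite !mxE (ltn_eqF (leq_trans (ltn_ord j) mk)) mulr0.
  by rewrite (ltn_eqF (leq_trans (ltn_ord i) (leq_trans mk _))).
rewrite (bigD1 (Ordinal km)) //= !mxE eqxx mulr1 big1 ?addr0 // => j jk.
rewrite !mxE (_ : (j == k :> nat) = false) ?mulr0 //.
by apply: contraNF jk => /eqP jk; apply/eqP/val_inj.
Qed.

Lemma shiftX_unit_col m l : shift_mx m ^+ l *m unit_col m 0 = unit_col m l.
Proof.
elim: l => [|l IHl]; first by rewrite expr0 mul1mx.
by rewrite exprS -mulmxE -mulmxA IHl shift_unit_col.
Qed.

Lemma unit_col_out m : unit_col m m = 0.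
Proof. by apply/matrixP => i o; rewrite !mxE (ltn_eqF (ltn_ord i)). Qed.

(** The exponential of [t *: shift_mx m] applied to the first basis vector. *)
Definition nilpotent_flow m (t : C) : 'cV[C]_m :=
  \sum_(k < m) (t ^+ k / k`!%:R) *: unit_col m k.

Lemma is_derive_nilpotent_flow m t :
  is_derive t (1 : C) (nilpotent_flow m) (shift_mx m *m nilpotent_flow m t).
Proof.
have -> : nilpotent_flow m = \sum_(k < m) (fun t => (t ^+ k / k`!%:R) *: unit_col m k).
  by apply/funext => u; rewrite fct_sumE.
have dterm (k : 'I_m) :
    is_derive t (1 : C) (fun t : C => (t ^+ k / k`!%:R) *: unit_col m k)
    ((k%:R * t ^+ k.-1 / k`!%:R) *: unit_col m k).
  apply: is_deriveZl.
  have -> : (fun z : C => z ^+ k / k`!%:R) = (k`!%:R^-1 \*: (id ^+ k : C -> C)).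
    by apply/funext => z; rewrite /= mulrC fctE.
  have hX := @is_deriveX C C (@id C) k t 1 1 (is_derive_id t 1).
  have hZ := @is_deriveZ C C C (id ^+ k) k`!%:R^-1 t 1 _ hX.
  apply: (is_derive_eq hZ).
  by rewrite /GRing.scale /= mulr1 mulrC.
apply: is_derive_eq.
rewrite fct_sumE mulmx_sumr.
case: m dterm => [|m] dterm; first by rewrite !big_ord0.
rewrite big_ord_recl /= !mul0r scale0r add0r [RHS]big_ord_recr /=.
rewrite -scalemxAr shift_unit_col unit_col_out scaler0 addr0.
apply: eq_bigr => k _; rewrite -scalemxAr shift_unit_col. 
rewrite /bump leq0n !add1n add0n; congr (_ *: _).
have k1 : k.+1%:R != 0 :> C by rewrite pnatr_eq0.
have kf : k`!%:R != 0 :> C by rewrite pnatr_eq0 -lt0n fact_gt0.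
by rewrite factS natrM invfM mulrACA divff // mul1r.
Qed.

Lemma cancel_of_le_higher_power (c k : C) (a b : nat) : (a < b)%N -> 0 <= k ->
  (\forall tau \near (0 : C), `|tau ^+ a * c| <= k * `|tau ^+ b|) -> c = 0.
Proof.
move=> ab k0 near_le; apply/eqP; rewrite -normr_le0; apply/ler_addgt0Pl => e e0.
rewrite addr0; near (0 : C)^' => tau.
have tau0 : tau != 0 by near: tau; exact: nbhs_dnbhs_neq.
have tau1 : `|tau| <= 1 by near: tau; apply: dnbhs0_le.
have taue : `|tau| <= e / (k + 1).
  by near: tau; apply: dnbhs0_le; rewrite divr_gt0 // ltr_wpDl.
have : `|tau ^+ a * c| <= k * `|tau ^+ b| by near: tau; exact: cvg_within.
rewrite normrM -(subnKC ab) addSn -addnS exprD [`|tau ^+ a * _|]normrM mulrCA.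
rewrite ler_pM2l ?normr_gt0 ?expf_neq0 // => /le_trans; apply.
apply: (@le_trans _ _ (k * `|tau|)).
  rewrite ler_wpM2l // exprS normrM -[leRHS]mulr1 ler_wpM2l //.
  by rewrite normrX exprn_ile1.
apply: (@le_trans _ _ (k * (e / (k + 1)))); first by rewrite ler_wpM2l.
rewrite mulrA ler_pdivrMr ?ltr_wpDl // mulrDr mulr1 mulrC lerDl ltW //.
Unshelve. all: by end_near. Qed.

(** On the shift in dimension [p.+1] the entry [l.+1] of the consistency error is the
single monomial [tau ^+ l.+1 * ((l.+1`!)^-1 - step_weight M l)], whose degree is too
low for it to be O(tau^(p+1)) unless the coefficient vanishes. *)
Lemma order_step_weight s (M : explicit_rk R s) p l :
  has_order M p -> (l < p)%N -> (l < s)%N -> step_weight M l = (l.+1`!%:R)^-1.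
Proof.
move=> M_order lp ls; pose m := p.+1; pose N := shift_mx m.
have flow0 : nilpotent_flow m 0 = unit_col m 0.
  rewrite /nilpotent_flow big_ord_recl /= expr0 fact0 divr1 scale1r big1 ?addr0 //.
  by move=> k _; rewrite expr0n mul0r scale0r.
have lm : (l.+1 < m)%N by [].
pose i := Ordinal lm.
have entry tau : (nilpotent_flow m (0 + tau) -
    rk_step M (fun=> mulmx N) 0 (nilpotent_flow m 0) tau) i 0 =
    tau ^+ l.+1 * ((l.+1`!%:R)^-1 - step_weight M l).
  rewrite add0r rk_step_linear flow0 /nilpotent_flow !mxE !summxE /= add0r mulrBr.
  rewrite (bigD1 i) //= !mxE eqxx mulr1 big1 => [|k ki]; last first.
    rewrite !mxE (_ : (l.+1 == k :> nat) = false) ?mulr0 //.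
    by apply: contraNF ki => /eqP ki; apply/eqP/val_inj.
  rewrite addr0 (bigD1 (Ordinal ls)) //= shiftX_unit_col !mxE eqxx mulr1.
  rewrite big1 => [|k kl]; last first.
    rewrite shiftX_unit_col !mxE eqSS (_ : (l == k :> nat) = false) ?mulr0 //.
    by apply: contraNF kl => /eqP kl; apply/eqP/val_inj.
  by rewrite addr0.
have /eqO_exP[k [k0 near_le]] : (fun tau : C => nilpotent_flow m (0 + tau) -
    rk_step M (fun=> mulmx N) 0 (nilpotent_flow m 0) tau)
    =O_ (nbhs (0 : C)) (fun tau : C => tau ^+ p.+1).
  apply: (M_order m (fun=> mulmx N) 0 (nilpotent_flow m)).
    apply: (filterE (nbhs_filter ((0, nilpotent_flow m 0) : C * _))) => z.
    exact: differentiable_mulmx_snd.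
  by apply: (filterE (nbhs_filter (0 : C))) => t; exact: is_derive_nilpotent_flow.
apply/esym/eqP; rewrite -subr_eq0; apply/eqP.
apply: (@cancel_of_le_higher_power _ k l.+1 p.+1); [by []|exact: ltW|].
apply: filterS near_le => tau; rewrite -entry; apply: le_trans.
exact: normr_le_mxnorm.
Qed.

(** With as many stages as the order, the order conditions determine every
coefficient of the stability polynomial. *)
Lemma rk_step_of_full_order p (M : explicit_rk R p) m (A : 'M[C]_m) t x tau :
  has_order M p -> rk_step M (fun=> mulmx A) t x tau = exp_trunc A p.+1 tau *m x.
Proof.
move=> M_order; rewrite rk_step_linear /exp_trunc big_mkord big_ord_recl mulmxDl.
rewrite expr0 fact0 divr1 scale1r mul1mx mulmx_suml; congr (_ + _).
apply: eq_bigr => l _; rewrite lift0 -scalemxAl.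
by rewrite (order_step_weight M_order (ltn_ord l) (ltn_ord l)).
Qed.

End LinearRungeKutta.

(** * Error of the composed steps *)

Section GlobalError.
Variables (R : realType) (d : nat).
Local Notation C := R[i].

(** The product of the factors [1 + w j] agrees with [1 + \sum_j w j] up to second
order in [n%:R * omega].  The smallness assumption
keeps the growth of [y] linear in the number of steps. *)
Lemma norm1_perturbed_recursion (w : nat -> 'M[C]_d) (y : nat -> 'cV[C]_d) (omega : R) n :
  (forall j, (j < n)%N -> y j.+1 = y j + w j *m y j) ->
  (forall j, (j < n)%N -> norm1 (w j) <= omega) ->
  0 <= omega -> n%:R * omega <= 2^-1 ->
  norm1 (y n - y 0 - \sum_(j < n) w j *m y 0) <= 2 * (n%:R * omega) ^+ 2 * norm1 (y 0).
Proof.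
move=> yS w_le omega0 n_omega.
have Y0 := norm1_ge0 (y 0).
have first_order k : (k <= n)%N -> norm1 (y k - y 0) <= 2 * k%:R * omega * norm1 (y 0).
  elim: k => [_|k IHk kn]; first by rewrite subrr norm1_0 mulr0 !mul0r.
  have k_omega : k%:R * omega <= 2^-1.
    by apply: le_trans n_omega; rewrite ler_wpM2r // ler_nat ltnW.
  have -> : y k.+1 - y 0 = (y k - y 0) + w k *m (y k - y 0) + w k *m y 0.
    by rewrite yS // mulmxBr addrA subrK addrAC.
  apply: le_trans (norm1D _ _) _; apply: (le_trans (lerD (norm1D _ _) (lexx _))).
  have IH := IHk (ltnW kn).
  have b1 : norm1 (w k *m (y k - y 0)) <= omega * (2 * k%:R * omega * norm1 (y 0)).
    by apply: le_trans (norm1M _ _) _; apply: ler_pM; rewrite ?norm1_ge0 ?w_le.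
  have b2 : norm1 (w k *m y 0) <= omega * norm1 (y 0).
    by apply: le_trans (norm1M _ _) _; rewrite ler_wpM2r ?w_le.
  (* This is where [k * omega <= 1 / 2] turns geometric into linear growth. *)
  have b3 : omega * (2 * k%:R * omega * norm1 (y 0)) <= omega * norm1 (y 0).
    by rewrite ler_wpM2l // -[leRHS]mul1r ler_wpM2r //; lra.
  rewrite -[k.+1%:R]natr1 mulrDr mulr1 !mulrDl; lra.
suff second_order k : (k <= n)%N ->
    norm1 (y k - y 0 - \sum_(j < k) w j *m y 0) <=
    2 * k%:R * n%:R * omega ^+ 2 * norm1 (y 0).
  by have := second_order n (leqnn n); rewrite exprMn expr2 !mulrA.
elim: k => [_|k IHk kn]; first by rewrite big_ord0 subrr subr0 norm1_0 mulr0 !mul0r.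
rewrite big_ord_recr /=.
have -> : y k.+1 - y 0 - (\sum_(j < k) w j *m y 0 + w k *m y 0) =
    (y k - y 0 - \sum_(j < k) w j *m y 0) + w k *m (y k - y 0).
  rewrite yS // mulmxBr opprD !addrA; congr (_ + _).
  by rewrite -!addrA; congr (_ + _); rewrite addrC -!addrA.
apply: le_trans (norm1D _ _) _.
have b1 : norm1 (w k *m (y k - y 0)) <= omega * (2 * k%:R * omega * norm1 (y 0)).
  apply: le_trans (norm1M _ _) _; apply: ler_pM; rewrite ?norm1_ge0 ?w_le //.
  exact: first_order (ltnW kn).
have b2 : omega * (2 * k%:R * omega * norm1 (y 0)) <= 2 * n%:R * omega ^+ 2 * norm1 (y 0).
  have -> : omega * (2 * k%:R * omega * norm1 (y 0)) =
    k%:R * (2 * omega ^+ 2 * norm1 (y 0)) by ring.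
  have -> : 2 * n%:R * omega ^+ 2 * norm1 (y 0) =
    n%:R * (2 * omega ^+ 2 * norm1 (y 0)) by ring.
  by rewrite ler_wpM2r ?ler_nat ?(ltnW kn) // mulr_ge0 // mulr_ge0 // exprn_ge0.
have IH := IHk (ltnW kn).
rewrite -[k.+1%:R]natr1 mulrDr mulr1 !mulrDl; lra.
Qed.

Variable A : 'M[C]_d.
(** A common bound for the flow and for the constants of its Taylor remainders, valid
for all times in the unit disc. *)
Let bound := norm1 (1%:M : 'M[C]_d) * expR (norm1 A).

(** The relative error of one step: [1 + local_defect] is the factor that a step
contributes to the numerical solution transported back to the initial node. *)
Definition local_defect (q : nat) (z : C) : 'M[C]_d :=
  expmx (- z *: A) *m exp_trunc A q z - 1%:M.

Definition exp_coef_mx (q : nat) : 'M[C]_d := (q`!%:R)^-1 *: A ^+ q.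

Lemma bound_ge0 : 0 <= bound.
Proof. by rewrite mulr_ge0 ?norm1_ge0 ?expR_ge0. Qed.

Lemma exp_truncS q z : exp_trunc A q.+1 z = exp_trunc A q z + z ^+ q *: exp_coef_mx q.
Proof. by rewrite /exp_trunc big_nat_recr //= /exp_coef_mx scalerA. Qed.

Lemma exp_trunc0 z : exp_trunc A 0 z = 0.
Proof. by rewrite /exp_trunc big_geq. Qed.

Lemma exp_trunc1 z : exp_trunc A 1 z = 1%:M.
Proof.
by rewrite exp_truncS exp_trunc0 add0r expr0 scale1r /exp_coef_mx fact0 invr1 scale1r.
Qed.

Lemma norm1_expmx_le z : cmod z <= 1 -> norm1 (expmx (z *: A)) <= bound.
Proof.
move=> z1; have := norm1_expmx_rem A 0 z1.
by rewrite exp_trunc0 subr0 expr0 mulr1.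
Qed.

(** The flow backwards cancels the flow, which exhibits the defect as a Taylor
remainder. *)
Lemma local_defectE q z :
  local_defect q z = - (expmx (- z *: A) *m (expmx (z *: A) - exp_trunc A q z)).
Proof. by rewrite mulmxBr expmxNK opprB. Qed.

Lemma norm1_local_defect q z : cmod z <= 1 ->
  norm1 (local_defect q z) <= bound ^+ 2 * cmod z ^+ q.
Proof.
move=> z1; rewrite local_defectE norm1N expr2 -mulrA.
apply: le_trans (norm1M _ _) _; apply: ler_pM; rewrite ?norm1_ge0 //.
  by apply: norm1_expmx_le; rewrite cmodN.
exact: norm1_expmx_rem.
Qed.

(** The defects of the truncations at [q] and at [q.+1] differ by the term of degree
[q], transported by [expmx (- z *: A)], which is the identity up to O(z). *)
Lemma norm1_local_defect_leading q z : cmod z <= 1 ->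
  norm1 (local_defect q z + z ^+ q *: exp_coef_mx q) <=
  (bound ^+ 2 + bound * norm1 (exp_coef_mx q)) * cmod z ^+ q.+1.
Proof.
move=> z1; have Nz1 : cmod (- z) <= 1 by rewrite cmodN.
have -> : local_defect q z + z ^+ q *: exp_coef_mx q =
    local_defect q.+1 z - (expmx (- z *: A) - 1%:M) *m (z ^+ q *: exp_coef_mx q).
  rewrite /local_defect exp_truncS mulmxDr mulmxBl mul1mx opprB.
  by rewrite [X in _ = X + _]addrAC !addrA [X in _ = X - _]addrAC addrK.
apply: le_trans (norm1D _ _) _; rewrite norm1N mulrDl lerD ?norm1_local_defect //.
apply: le_trans (norm1M _ _) _; rewrite norm1Z cmodX exprS.
have -> : bound * norm1 (exp_coef_mx q) * (cmod z * cmod z ^+ q) =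
  (bound * cmod z) * (cmod z ^+ q * norm1 (exp_coef_mx q)) by ring.
rewrite ler_wpM2r ?mulr_ge0 ?exprn_ge0 ?cmod_ge0 ?norm1_ge0 //.
by have := norm1_expmx_rem A 1 Nz1; rewrite exp_trunc1 cmodN expr1.
Qed.

Lemma comm_expmx_trunc q a z :
  exp_trunc A q z *m expmx (a *: A) = expmx (a *: A) *m exp_trunc A q z.
Proof.
apply: comm_expmx; rewrite /exp_trunc mulmx_suml mulmx_sumr; apply: eq_bigr => k _.
by rewrite -scalemxAl -scalemxAr; congr (_ *: _); rewrite mulmxE -exprSr exprS.
Qed.

(** The vanishing power sum removes the leading part of [\sum_j w j] exactly, since
this part is the power sum times one fixed matrix. *)
Lemma norm1_global_error q (P : nat -> C) (g : nat -> 'cV[C]_d) n (delta : R) :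
  (forall j, (j < n)%N -> g j.+1 = exp_trunc A q (P j.+1 - P j) *m g j) ->
  (forall j, (j < n)%N -> cmod (P j.+1 - P j) <= delta) ->
  \sum_(j < n) (P j.+1 - P j) ^+ q = 0 ->
  0 <= delta <= 1 -> n%:R * (bound ^+ 2 * delta ^+ q) <= 2^-1 ->
  norm1 (expmx ((P n - P 0) *: A) *m g 0 - g n) <=
  norm1 (expmx ((P n - P 0) *: A)) *
  (2 * (n%:R * (bound ^+ 2 * delta ^+ q)) ^+ 2 +
   n%:R * ((bound ^+ 2 + bound * norm1 (exp_coef_mx q)) * delta ^+ q.+1)) * norm1 (g 0).
Proof.
move=> gS step_le power_sum0 /andP[delta0 delta1] small.
(* The numerical solution, transported back to the initial node. *)
pose y j := expmx (- (P j - P 0) *: A) *m g j.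
pose w j := local_defect q (P j.+1 - P j).
have y0 : y 0 = g 0 by rewrite /y subrr oppr0 expmx0 mul1mx.
have gE : g n = expmx ((P n - P 0) *: A) *m y n.
  by rewrite /y mulmxA -expmxD addrN expmx0 mul1mx.
have step1 j : (j < n)%N -> cmod (P j.+1 - P j) <= 1.
  by move=> jn; apply: le_trans (step_le j jn) delta1.
have yS j : (j < n)%N -> y j.+1 = y j + w j *m y j.
  move=> jn; rewrite /w /local_defect mulmxBl mul1mx addrC subrK /y gS //.
  have -> : - (P j.+1 - P 0) = - (P j.+1 - P j) + - (P j - P 0).
    by rewrite -opprD addrA subrK.
  have swap (X Y T : 'M[C]_d) (v : 'cV[C]_d) :
      T *m Y = Y *m T -> X *m Y *m (T *m v) = X *m T *m (Y *m v).
    by move=> TY; rewrite !mulmxA -(mulmxA X Y) -TY !mulmxA.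
  by rewrite expmxD; apply: swap; exact: comm_expmx_trunc.
have w_le j : (j < n)%N -> norm1 (w j) <= bound ^+ 2 * delta ^+ q.
  move=> jn; apply: le_trans (norm1_local_defect q (step1 j jn)) _.
  rewrite ler_wpM2l ?exprn_ge0 ?bound_ge0 //.
  by apply: lerXn2r; rewrite ?nnegrE ?cmod_ge0 ?step_le.
have omega0 : 0 <= bound ^+ 2 * delta ^+ q by rewrite mulr_ge0 ?exprn_ge0 ?bound_ge0.
have := norm1_perturbed_recursion yS w_le omega0 small.
set b := _ * _ ^+ 2 => rec; rewrite y0 in rec.
have sum_w : norm1 (\sum_(j < n) w j *m g 0) <=
    n%:R * ((bound ^+ 2 + bound * norm1 (exp_coef_mx q)) * delta ^+ q.+1) * norm1 (g 0).
  rewrite -mulmx_suml; apply: le_trans (norm1M _ _) _; rewrite ler_wpM2r ?norm1_ge0 //.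
  have -> : \sum_(j < n) w j = \sum_(j < n) (w j + (P j.+1 - P j) ^+ q *: exp_coef_mx q).
    rewrite [RHS]big_split /=; have := scaler_suml (exp_coef_mx q) (index_enum 'I_n)
      xpredT (fun j : 'I_n => (P j.+1 - P j) ^+ q).
    by rewrite power_sum0 scale0r => <-; rewrite addr0.
  apply: le_trans (norm1_sum _ _ _) _.
  rewrite -[n in n%:R]card_ord mulr_natl -sumr_const; apply: ler_sum => j _.
  apply: le_trans (norm1_local_defect_leading q (step1 j (ltn_ord j))) _.
  rewrite ler_wpM2l ?addr_ge0 ?mulr_ge0 ?exprn_ge0 ?bound_ge0 ?norm1_ge0 //.
  by apply: lerXn2r; rewrite ?nnegrE ?cmod_ge0 ?step_le.
rewrite gE -mulmxBr; apply: le_trans (norm1M _ _) _; rewrite -mulrA.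
rewrite ler_wpM2l ?norm1_ge0 // norm1B.
have -> : y n - g 0 = (y n - g 0 - \sum_(j < n) w j *m g 0) + \sum_(j < n) w j *m g 0.
  by rewrite subrK.
by apply: le_trans (norm1D _ _) _; rewrite mulrDl lerD.
Qed.

End GlobalError.

(** * Lower bound for the mesh of a non-constant curve *)

Section CurveMesh.
Variables (R : realType) (gamma : R -> R[i]).
Local Notation C := R[i].

(** Near [u] the difference quotient is bounded by the modulus of its limit plus 1. *)
Lemma curve_derivable_continuous u (e : R) : curve_derivable gamma u -> 0 < e ->
  exists2 r : R, 0 < r &
    forall v, v \in `[0, 1] -> `|v - u| < r -> cmod (gamma v - gamma u) < e.
Proof.
move=> /cvg_ex[l quot_l] e0.
have : \forall v \near u, v != u -> v \in `[0, 1] ->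
    cmod (curve_quotient gamma u v) <= cmod l + 1.
  move/cvgrPdist_lt: quot_l => /(_ 1 ltr01).
  rewrite !near_withinE; apply: filterS => v Hv vu v01.
  have := Hv vu v01; rewrite normr_cmod -[1 : C]/((1 : R)%:C) ltcR => lt1.
  rewrite -[curve_quotient _ _ _](subrK l) addrC; apply: le_trans (cmodD _ _) _.
  by rewrite lerD2l cmodB ltW.
move=> /nbhs_ballP[r /= r0 quot_le].
have K0 : 0 < cmod l + 1 by rewrite ltr_wpDl ?cmod_ge0.
exists (Num.min r (e / (cmod l + 1))).
  by rewrite lt_min r0 divr_gt0.
move=> v v01; rewrite lt_min => /andP[vr ve].
have [->|vu] := eqVneq v u; first by rewrite subrr ComplexField.Normc.normc0.
have q_le := quot_le v (_ : ball u r v) vu v01.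
have -> : gamma v - gamma u = curve_quotient gamma u v * (v - u)%:C.
  rewrite /curve_quotient divfK //; apply: contra vu => /eqP/(@complexI R)/eqP.
  by rewrite subr_eq0.
rewrite cmodM cmod_real; apply: (@le_lt_trans _ _ ((cmod l + 1) * `|v - u|)).
  by rewrite ler_wpM2r // q_le // /ball /= distrC.
by rewrite mulrC -ltr_pdivlMr.
Qed.

Lemma cmod_grid_step_le n j : (j < n)%N -> cmod (grid_step gamma n j) <= mesh gamma n.
Proof.
move=> jn.
exact: (le_bigmax 0 (fun j : 'I_n => cmod (grid_step gamma n j)) (Ordinal jn)).
Qed.

Lemma mesh_ge0 n : 0 <= mesh gamma n.
Proof.
rewrite /mesh; elim/big_rec: _ => // j x _ x0.
by rewrite le_max x0 orbT.
Qed.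

Lemma cmod_grid_point_dist n j k : (j <= n)%N -> (k <= n)%N ->
  cmod (grid_point gamma n k - grid_point gamma n j) <= n%:R * mesh gamma n.
Proof.
wlog jk : j k / (j <= k)%N.
  move=> hwlog jn kn; have [jk|/ltnW kj] := leqP j k; first exact: hwlog.
  by rewrite cmodB; exact: hwlog.
move=> _ kn; rewrite -(telescope_sumr (grid_point gamma n) jk).
apply: le_trans (cmod_sum _ _ _) _.
apply: (@le_trans _ _ (\sum_(j <= i < k) mesh gamma n)).
  apply: ler_sum_nat => i /andP[_ ik].
  exact: cmod_grid_step_le (leq_trans ik kn).
rewrite big_const_nat iter_addr_0 -[leLHS]mulr_natl ler_wpM2r ?mesh_ge0 //.
by rewrite ler_nat (leq_trans (leq_subr _ _)).
Qed.

Lemma grid_approximation (u : R) n : u \in `[0, 1] -> (0 < n)%N ->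
  exists j, [/\ (j <= n)%N, j%:R / n%:R \in (`[0, 1] : interval R) &
    `|j%:R / n%:R - u| <= n%:R^-1].
Proof.
rewrite in_itv /= => /andP[u0 u1] n0.
have n0R : 0 < n%:R :> R by rewrite ltr0n.
have [lo hi] := andP (truncn_itv (mulr_ge0 u0 (ltW n0R))).
set j := Num.trunc _ in lo hi.
have jn_le : j%:R / n%:R <= u by rewrite ler_pdivrMr.
exists j; split.
- rewrite -(ler_nat R); apply: le_trans lo _.
  by rewrite -[leRHS]mul1r ler_wpM2r // ltW.
- by rewrite in_itv /= divr_ge0 ?ler0n //= (le_trans jn_le).
- have : u <= j.+1%:R / n%:R by rewrite ler_pdivlMr // ltW.
  by rewrite -natr1 mulrDl mul1r distrC ger0_norm ?subr_ge0 // lerBlDr addrC.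
Qed.

(** Two points of the curve at distance [4 * e] are approximated within [e] by grid
points, which are then at distance at least [2 * e]. *)
Lemma mesh_lower_bound :
  (forall u, u \in `[0, 1] -> curve_derivable gamma u) ->
  (exists u v : R, [/\ u \in `[0, 1], v \in `[0, 1] & gamma u != gamma v]) ->
  exists2 c : R, 0 < c & \forall n \near \oo, c <= n%:R * mesh gamma n.
Proof.
move=> derivable_gamma [u [v [u01 v01 guv]]].
pose e := cmod (gamma u - gamma v) / 4.
have e0 : 0 < e.
  rewrite divr_gt0 // lt_neqAle cmod_ge0 andbT eq_sym.
  apply: contra guv => /eqP/(@ComplexField.Normc.eq0_normc R)/eqP.
  by rewrite subr_eq0.
have [r r0 near_u] := curve_derivable_continuous (derivable_gamma u u01) e0.
have [s s0 near_v] := curve_derivable_continuous (derivable_gamma v v01) e0.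
exists e => //; near=> n.
have n0 : (0 < n)%N by near: n; exact: nbhs_infty_gt.
have n0R : 0 < n%:R :> R by rewrite ltr0n.
have nr : n%:R^-1 < r.
  rewrite -[r]invrK ltf_pV2 ?posrE ?invr_gt0 //; near: n; exact: nbhs_infty_gtr.
have ns : n%:R^-1 < s.
  rewrite -[s]invrK ltf_pV2 ?posrE ?invr_gt0 //; near: n; exact: nbhs_infty_gtr.
have [j [jn j01 ju]] := grid_approximation u01 n0.
have [k [kn k01 kv]] := grid_approximation v01 n0.
have Hu := near_u _ j01 (le_lt_trans ju nr).
have Hv := near_v _ k01 (le_lt_trans kv ns).
have Hjk := cmod_grid_point_dist kn jn.
rewrite -!/(grid_point gamma n _) in Hu Hv.
have tri : cmod (gamma u - gamma v) <= cmod (grid_point gamma n j - gamma u) +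
    cmod (grid_point gamma n j - grid_point gamma n k) +
    cmod (grid_point gamma n k - gamma v).
  have -> : gamma u - gamma v = (gamma u - grid_point gamma n j) +
     (grid_point gamma n j - grid_point gamma n k) + (grid_point gamma n k - gamma v).
    by rewrite !addrA !subrK.
  apply: le_trans (cmodD _ _) _; rewrite lerD2r; apply: le_trans (cmodD _ _) _.
  by rewrite lerD2r cmodB.
have e4 : cmod (gamma u - gamma v) = 4 * e by rewrite /e mulrC divfK.
lra.
Unshelve. all: by end_near. Qed.

End CurveMesh.

(** * Convergence of order p + 1 at the terminal point *)

Theorem proposition4p1 (R : realType) (d p : nat) (d_gt0 : (0 < d)%N)
    (p_gt0 : (0 < p)%N) (A : 'M[R[i]]_d) (x0 : 'cV[R[i]]_d) (t0 t : R[i])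
    (gamma : R -> R[i]) (gamma_C1 : C1_curve gamma)
    (gamma_nonconstant :
      exists u v : R, [/\ u \in `[0, 1], v \in `[0, 1] & gamma u != gamma v])
    (gamma0 : gamma 0 = t0) (gamma1 : gamma 1 = t)
    (C : R) (C_gt0 : 0 < C)
    (mesh_le : forall n : nat, (0 < n)%N ->
      mesh gamma n <= C * (curve_length gamma / n%:R))
    (M : explicit_rk R p) (M_order : has_order M p)
    (eps : nat -> 'cV[R[i]]_d)
    (epsE : forall n : nat, eps n =
      expmx ((t - t0) *: A) *m x0 - grid_function gamma M (fun=> mulmx A) x0 n n)
    (power_sums : exists N : nat, forall n : nat, (0 < n)%N -> (N <= n)%N ->
      \sum_(j < n) grid_step gamma n j ^+ p.+1 = 0) :
  (fun n => ((mesh gamma n ^+ p)^-1)%:C *: eps n) @ \oo --> (0 : 'cV[R[i]]_d) /\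
  eps =O_ \oo (fun n : nat => (n%:R ^- p.+1 : R[i])).
Proof.
(* [K / n] bounds the steps and [D] the flow on the unit disc; [a] comes from the
   size of the defects, [b] from their remainders. *)
pose K := C * curve_length gamma.
pose D := norm1 (1%:M : 'M[R[i]]_d) * expR (norm1 A).
pose b := D ^+ 2 + D * norm1 (exp_coef_mx A p.+1).
pose a := D ^+ 2 * K ^+ p.+1.
pose G := norm1 (expmx ((t - t0) *: A)) * (2 * a ^+ 2 + b * K ^+ p.+2) * norm1 x0.
have D0 : 0 <= D by rewrite mulr_ge0 ?norm1_ge0 ?expR_ge0.
have b0 : 0 <= b by rewrite addr_ge0 ?mulr_ge0 ?exprn_ge0 ?norm1_ge0.
have mesh_leK n : (0 < n)%N -> mesh gamma n <= K / n%:R.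
  by move=> n0; rewrite /K -mulrA; exact: mesh_le.
have K0 : 0 <= K.
  by have := le_trans (mesh_ge0 gamma 1) (mesh_leK 1%N isT); rewrite divr1.
have a0 : 0 <= a by rewrite mulr_ge0 ?exprn_ge0.
have G0 : 0 <= G.
  by rewrite !mulr_ge0 ?norm1_ge0 ?addr_ge0 //; apply: mulr_ge0; rewrite ?exprn_ge0.
have [N sum0] := power_sums.
have eps_le : \forall n \near \oo, norm1 (eps n) <= G * n%:R^-1 ^+ p.+1.
  near=> n.
  have n0 : (0 < n)%N by near: n; exact: nbhs_infty_gt.
  have n0R : 0 < n%:R :> R by rewrite ltr0n.
  pose h : R := n%:R^-1.
  have h0 : 0 <= h by rewrite invr_ge0 ltW.
  have h1 : h <= 1 by rewrite invf_le1 // ler1n.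
  have nh : n%:R * h = 1 by rewrite mulfV // gt_eqF.
  have Kh1 : K * h <= 1.
    rewrite ler_pdivrMr // mul1r; near: n; exact: nbhs_infty_ger.
  have ah : n%:R * (D ^+ 2 * (K * h) ^+ p.+1) = a * h ^+ p.
    rewrite (exprMn _ K h) (exprS h) /a.
    by transitivity (n%:R * h * (D ^+ 2 * K ^+ p.+1 * h ^+ p)); [ring|rewrite nh mul1r].
  have bh : n%:R * (b * (K * h) ^+ p.+2) = b * K ^+ p.+2 * h ^+ p.+1.
    rewrite (exprMn _ K h) (exprS h p.+1).
    by transitivity (n%:R * h * (b * K ^+ p.+2 * h ^+ p.+1)); [ring|rewrite nh mul1r].
  have small : n%:R * (D ^+ 2 * (K * h) ^+ p.+1) <= 2^-1.
    rewrite ah; apply: (@le_trans _ _ (a * h)).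
      by rewrite ler_wpM2l // -(prednK p_gt0) exprS ler_piMr // exprn_ile1.
    rewrite ler_pdivrMr // mulrC ler_pdivlMr //; near: n; exact: nbhs_infty_ger.
  have gS j : (j < n)%N -> grid_function gamma M (fun=> mulmx A) x0 n j.+1 =
      exp_trunc A p.+1 (grid_point gamma n j.+1 - grid_point gamma n j) *m
      grid_function gamma M (fun=> mulmx A) x0 n j.
    by move=> _; exact: rk_step_of_full_order.
  have step_le j : (j < n)%N ->
      cmod (grid_point gamma n j.+1 - grid_point gamma n j) <= K * h.
    by move=> jn; apply: le_trans (cmod_grid_step_le gamma jn) (mesh_leK n n0).
  have Nn : (N <= n)%N by near: n; exact: nbhs_infty_ge.
  have Kh01 : 0 <= K * h <= 1 by rewrite mulr_ge0.
  have := norm1_global_error gS step_le (sum0 n n0 Nn) Kh01 small.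
  rewrite -/D -/b ah bh /grid_point divff ?gt_eqF // mul0r gamma0 gamma1 -epsE.
  move=> /le_trans; apply.
  rewrite /G -/h [leRHS]mulrAC ler_wpM2r ?norm1_ge0 // -[leRHS]mulrA.
  rewrite ler_wpM2l ?norm1_ge0 // [leRHS]mulrDl lerD2r -[leRHS]mulrA ler_wpM2l //.
  (* The second-order terms are O(n^-2p), and [2 * p >= p.+1]. *)
  rewrite (exprMn _ a) ler_wpM2l ?exprn_ge0 // -exprM ler_wiXn2l //.
  by rewrite muln2 -addnn -addn1 leq_add2l.
split; last first.
  apply/eqO_exP; exists (G + 1)%:C.
    by rewrite -[0]/((0 : R)%:C) ltcR ltr_wpDl.
  apply: filterS eps_le => n n_le.
  apply: le_trans (mxnorm_le_norm1 _) _.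
  rewrite normr_cmod cmodV cmodX cmod_nat -rmorphM lecR -exprVn.
  apply: (le_trans n_le); apply: ler_wpM2r; last by rewrite lerDl.
  by rewrite exprn_ge0 ?invr_ge0 ?ler0n.
have [u_derivable _] := gamma_C1.
have [c c0 mesh_ge] := mesh_lower_bound u_derivable gamma_nonconstant.
apply: cvg_norm1.
apply: (@squeeze_cvgr _ _ _ _ (fun=> 0) (fun n => G / c ^+ p * n%:R^-1)).
- near=> n; rewrite norm1_ge0 /=.
  have n0 : (0 < n)%N by near: n; exact: nbhs_infty_gt.
  have n0R : 0 < n%:R :> R by rewrite ltr0n.
  have n_le : norm1 (eps n) <= G * n%:R^-1 ^+ p.+1 by near: n; exact: eps_le.
  have n_ge : c <= n%:R * mesh gamma n by near: n; exact: mesh_ge.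
  have mesh_gt0 : 0 < mesh gamma n.
    by rewrite -(pmulr_rgt0 _ n0R); exact: lt_le_trans c0 n_ge.
  rewrite subr0 norm1Z cmod_real ger0_norm ?invr_ge0 ?exprn_ge0 ?mesh_ge0 //.
  rewrite mulrC ler_pdivrMr ?exprn_gt0 //; apply: (le_trans n_le).
  have ch : (c * n%:R^-1) ^+ p <= mesh gamma n ^+ p.
    apply: lerXn2r; rewrite ?nnegrE ?mesh_ge0 //.
      by rewrite divr_ge0 ?ler0n // ltW.
    by rewrite ler_pdivrMr // mulrC.
  have -> : G * n%:R^-1 ^+ p.+1 = G / c ^+ p * n%:R^-1 * (c * n%:R^-1) ^+ p.
    have cp : c ^+ p != 0 by rewrite expf_neq0 // gt_eqF.
    rewrite exprMn exprS.
    transitivity (c ^+ p / c ^+ p * (G * (n%:R^-1 * n%:R^-1 ^+ p))); last by ring.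
    by rewrite mulfV // mul1r.
  apply: ler_wpM2l ch; rewrite mulr_ge0 ?invr_ge0 ?ler0n // divr_ge0 //.
  by rewrite exprn_ge0 // ltW.
- exact: cvg_cst.
- suff: (fun n => G / c ^+ p * n%:R^-1) @ \oo --> (G / c ^+ p * 0 : R).
    by rewrite mulr0.
  apply: cvgMl_tmp; rewrite -cvg_shiftS; exact: cvg_harmonic.
Unshelve. all: by end_near. Qed.
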